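(* There exist absolute constants $c,C>0$ such that for every $n\in\mathbb N$, if $K\subseteq\mathbb R^n$ is a convex body with $B_2^n\subseteq K$, $q\geq1$, and $N\in\mathbb N$ satisfies $(C\,D_q(K))^2\leq N\leq e^q$, then $$\frac{1}{(G_n(K))^N}\sum_{x_1,\ldots,x_N\in K\cap\mathbb Z^n}\max_{1\leq i\leq N}|\langle x_i,e_n\rangle|\geq c\left(\frac{1}{G_n(K)}\sum_{x\in K\cap\mathbb Z^n}|\langle x,e_n\rangle|^{\frac{\log N}{2\log(C D_q(K))}}\right)^{\frac{2\log(C D_q(K))}{\log N}}.$$
   Context: A convex body is a compact convex subset of $\mathbb R^n$ with non-empty interior. $(e_i)_{i=1}^n$ is the canonical basis of $\mathbb R^n$, $B_2^n$ is the closed Euclidean unit ball, $O(n)$ is the group of orthogonal $n\times n$ matrices, and $\log$ is the natural logarithm. For a bounded set $L\subseteq\mathbb R^n$, $G_n(L)$ is the cardinality of $L\cap\mathbb Z^n$. Put $C_n=(-1,1)^n$; sums of sets are Minkowski sums. For a convex body $L\subseteq\mathbb R^n$ with $\max_{x\in L\cap\mathbb Z^n}|\langle x,e_n\rangle|\geq 1$ and $p\geq1$, define $$D_0(L,p):=\frac{1+\left(\mathbb E|\langle Y,e_n\rangle|^p\right)^{\frac1p}\left(\frac{G_n(L+C_n)}{G_n(L)}\right)^{\frac1p}}{\left(\mathbb E|\langle X,e_n\rangle|^p\right)^{\frac1p}},$$ where $X$ is uniformly distributed on the finite set $L\cap\mathbb Z^n$ and $Y$ is uniformly distributed on the finite set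 $(L+C_n)\cap\mathbb Z^n$. For a convex body $L\subseteq\mathbb R^n$ with $B_2^n\subseteq L$ and $q\geq1$, define $$D_q(L):=\sup_{U\in O(n),\ 1\leq p\leq q}D_0(UL,p).$$ The sum on the left-hand side of the claim runs over all $N$-tuples in $(K\cap\mathbb Z^n)^N$. Absolute constants are numbers independent of all parameters ($n$, $K$, $q$, $N$). *)

(* Defs.v *)
From mathcomp Require Import all_boot all_order all_algebra finmap.
From mathcomp Require Import all_classical all_reals all_analysis.

Set Implicit Arguments.
Unset Strict Implicit.
Unset Printing Implicit Defensive.

Import Order.TTheory GRing.Theory Num.Theory.
Import numFieldNormedType.Exports.

Local Open Scope classical_set_scope.
Local Open Scope ring_scope.

(* R^n is 'rV[R]_n, with the topology of the library (that of the sup norm,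
   hence the usual one).  Where the last basis vector e_n is involved the
   dimension is written n.+1, so that it ranges over the positive integers. *)

Definition inner (R : realType) (n : nat) (x y : 'rV[R]_n) : R :=
  \sum_(i < n) x 0 i * y 0 i.

Definition last_basis (R : realType) (n : nat) : 'rV[R]_n.+1 :=
  delta_mx 0 ord_max.

Definition euclidean_ball (R : realType) (n : nat) : set 'rV[R]_n :=
  [set x | Num.sqrt (inner x x) <= 1].

Definition convex_body (R : realType) (n : nat) (K : set 'rV[R]_n) : Prop :=
  [/\ compact K, convex_set K & K° !=set0].

Definition open_cube (R : realType) (n : nat) : set 'rV[R]_n :=
  [set x | forall i, -1 < x 0 i < 1].

Definition minkowski_sum (R : realType) (n : nat) (A B : set 'rV[R]_n) :
    set 'rV[R]_n :=
  [set x + y | x in A & y in B].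

Definition orthogonal_group (R : realType) (n : nat) : set 'M[R]_n :=
  [set U | U *m U^T = 1%:M].

(* The image U L; as vectors are rows, U acts by right multiplication by its
   transpose. *)
Definition mx_image (R : realType) (n : nat) (U : 'M[R]_n) (L : set 'rV[R]_n) :
    set 'rV[R]_n :=
  [set x *m U^T | x in L].

Definition integer_points (R : realType) (n : nat) : set 'rV[R]_n :=
  [set x | forall i, x 0 i \is a Num.int].

(* [fset_set] is the given set when that set is finite (and is empty
   otherwise); it is only used below for bounded L. *)
Definition lattice_points (R : realType) (n : nat) (L : set 'rV[R]_n) :
    {fset 'rV[R]_n} :=
  fset_set (L `&` @integer_points R n).

Definition lattice_count (R : realType) (n : nat) (L : set 'rV[R]_n) : nat :=
  #|` lattice_points L|.

(* Expectation of f(X), for X uniform on the lattice points of L. *)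
Definition lattice_mean (R : realType) (n : nat) (L : set 'rV[R]_n)
    (f : 'rV[R]_n -> R) : R :=
  (\sum_(x <- lattice_points L) f x) / (lattice_count L)%:R.

(* (E |<X, e_n>|^p)^(1/p), for X uniform on the lattice points of L. *)
Definition last_moment (R : realType) (n : nat) (L : set 'rV[R]_n.+1) (p : R) : R :=
  lattice_mean L (fun x => `|inner x (last_basis R n)| `^ p) `^ p^-1.

Definition D0 (R : realType) (n : nat) (L : set 'rV[R]_n.+1) (p : R) : R :=
  let LC := minkowski_sum L (@open_cube R n.+1) in
  (1 + last_moment LC p
       * ((lattice_count LC)%:R / (lattice_count L)%:R) `^ p^-1)
  / last_moment L p.

(* For a convex body L containing the Euclidean unit ball, the lattice points
   of U L + C_n are taken in a fixed bounded set and the denominators of D0 are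
   bounded away from 0, so this is the supremum of a nonempty bounded set. *)
Definition Dq (R : realType) (n : nat) (L : set 'rV[R]_n.+1) (q : R) : R :=
  sup [set D | exists U p, [/\ @orthogonal_group R n.+1 U, 1 <= p <= q
                             & D = D0 (mx_image U L) p]].

(* Main.v *)
Require Import Defs.
From mathcomp Require Import all_boot all_order all_algebra finmap.
From mathcomp Require Import all_classical all_reals all_analysis.
From mathcomp Require Import zify ring lra.

(* Write X_n for <X, e_n>.  By Paley-Zygmund, a reverse Hoelder inequality
   E|X_n|^(2p) <= (32 D)^(2p) (E|X_n|^p)^2 gives
   |X_n|^p >= E|X_n|^p / 2 with probability at least (32 D)^(-2p) / 4, which is
   1/(4N) for the exponent p of the theorem, so that with probability bounded
   below one of N independent copies of X reaches half the p-th moment norm.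
   The reverse Hoelder inequality is proved on the lattice, with U = 1 only: if
   f(x) g(y) <= h(z)^2 whenever z is a coordinatewise rounding, up or down, of
   (x + y)/2, then (sum f)(sum g) <= (sum h)^2.  This discrete Prekopa-Leindler
   inequality follows in dimension one from |A| + |B| <= 2 |M|, M the set of
   rounded midpoints of A and B, and it tensorizes.  Roundings of midpoints of
   points of K lie in K + C_n, and this is how the numerator of D_0 arises. *)

Set Implicit Arguments.
Unset Strict Implicit.
Unset Printing Implicit Defensive.

Import Order.TTheory GRing.Theory Num.Theory.
Import numFieldNormedType.Exports.

Local Open Scope classical_set_scope.
Local Open Scope ring_scope.

(** * Discrete Prekopa-Leindler inequality in dimension one *)

(* m is (i + j)/2, rounded up or down. *)
Definition near_mid (i j m : nat) : bool :=
  (i + j <= m.*2.+1)%N && (m.*2 <= (i + j).+1)%N.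

(** With a = min A and b = max B, the numbers a + j for j in B and i + b + 1 for i in A are pairwise
    distinct, since a + j <= a + b < i + b + 1. Their integer halves lie in M, and each m is the
    half of 2m and 2m + 1 only. *)
Lemma card_near_mid (L : nat) (A B M : {set 'I_L}) :
  A != finset.set0 -> B != finset.set0 ->
  (forall i j m : 'I_L, i \in A -> j \in B -> near_mid i j m -> m \in M) ->
  (#|A| + #|B| <= #|M|.*2)%N.
Proof.
move=> /set0Pn[i0 Ai0] /set0Pn[j0 Bj0] ABM.
have [a Aa amin] := @arg_minnP _ i0 (fun i => i \in A) (fun i : 'I_L => i : nat) Ai0.
have [b Bb bmax] := @arg_maxnP _ j0 (fun i => i \in B) (fun i : 'I_L => i : nat) Bj0.
pose s := [seq (a + j)%N | j : 'I_L <- enum B] ++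
          [seq (i + b).+1 | i : 'I_L <- enum A].
pose t := [seq (m : nat).*2 | m : 'I_L <- enum M] ++
          [seq (m : nat).*2.+1 | m : 'I_L <- enum M].
have tP (x : nat) (m : 'I_L) : m \in M -> m = x./2 :> nat -> x \in t.
  move=> Mm mx; rewrite mem_cat; apply/orP; case: (boolP (odd x)) => ox.
    by right; apply/mapP; exists m; rewrite ?mem_enum//; lia.
  by left; apply/mapP; exists m; rewrite ?mem_enum//; lia.
have -> : (#|A| + #|B| = size s)%N by rewrite size_cat !size_map -!cardE addnC.
have -> : (#|M|.*2 = size t)%N by rewrite size_cat !size_map -!cardE addnn.
apply: uniq_leq_size.
  rewrite cat_uniq !map_inj_uniq ?enum_uniq ?andbT //=; last 2 first.
  - by move=> x y [] e; apply: val_inj => /=; lia.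
  - by move=> x y e; apply: val_inj => /=; lia.
  apply/hasPn => x /mapP[i]; rewrite mem_enum => Ai ->.
  apply/mapP => -[j]; rewrite mem_enum => Bj.
  by have := amin i Ai; have := bmax j Bj => /=; lia.
move=> x; rewrite mem_cat => /orP[] /mapP[i]; rewrite mem_enum => Ii ->.
  have lt : ((a + i)./2 < L)%N by have := ltn_ord a; have := ltn_ord i; lia.
  by apply: (@tP _ (Ordinal lt)) => //; apply: (ABM a i) => //; rewrite /near_mid /=; lia.
have lt : ((i + b).+1./2 < L)%N by have := ltn_ord b; have := ltn_ord i; lia.
by apply: (@tP _ (Ordinal lt)) => //; apply: (ABM i b) => //; rewrite /near_mid /=; lia.
Qed.

(* The layer-cake formula, by induction on the total size of the supports:
   the smallest positive value is stripped off from both functions at once. *)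
Lemma prekopa_leindler_min (R : realFieldType) (L : nat) (f g h : 'I_L -> R) (v : R) :
  (forall i, 0 <= f i) -> (forall i, 0 <= g i) -> (forall i, 0 <= h i) ->
  (forall i, f i <= v) -> (forall i, g i <= v) ->
  (exists i, f i = v) -> (exists i, g i = v) ->
  (forall i j m : 'I_L, near_mid i j m -> Num.min (f i) (g j) <= h m) ->
  \sum_i f i + \sum_i g i <= 2 * \sum_i h i.
Proof.
pose supp (u : 'I_L -> R) := [set i | 0 < u i]%SET.
have [k] := ubnP (#|supp f| + #|supp g|)%N.
elim: k f g h v => // k IH f g h v lek f0 g0 h0 fv gv [i0 fi0] [j0 gj0] fgh.
have v0 : 0 <= v by rewrite -fi0.
have [v_eq0|v_neq0] := eqVneq v 0.
  have z0 (u : 'I_L -> R) : (forall i, 0 <= u i) -> (forall i, u i <= v) -> \sum_i u i = 0.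
    by move=> u0 uv; rewrite big1 // => i _; apply: le_anti; rewrite u0 -v_eq0 uv.
  by rewrite (z0 f)// (z0 g)// addr0 mulr_ge0 ?sumr_ge0.
have vgt0 : 0 < v by rewrite lt0r v_neq0.
(* As f and g attain the same maximum v > 0, both supports are nonempty, which [card_near_mid]
   requires. *)
have Ai0 : i0 \in supp f by rewrite inE fi0.
have Bj0 : j0 \in supp g by rewrite inE gj0.
have [a Aa amin] := @arg_minP _ R _ i0 (fun i => i \in supp f) f Ai0.
have [b Bb bmin] := @arg_minP _ R _ j0 (fun i => i \in supp g) g Bj0.
rewrite /= !inE in Aa Bb.
pose t := Num.min (f a) (g b).
have t0 : 0 < t by rewrite lt_min Aa Bb.
have tf i : 0 < f i -> t <= f i.
  by move=> fi; rewrite ge_min amin //= inE.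
have tg i : 0 < g i -> t <= g i.
  by move=> fi; rewrite ge_min bmin ?orbT //= inE.
(* The near midpoints of the two supports: h >= t there, so t can be stripped from h on M as
   well. *)
pose M := [set m : 'I_L | [exists i : 'I_L, exists j : 'I_L,
  [&& 0 < f i, 0 < g j & near_mid i j m]]]%SET.
pose sub (A : {set 'I_L}) (u : 'I_L -> R) i := u i - t *+ (i \in A).
have sumE (A : {set 'I_L}) u : \sum_i sub A u i = \sum_i u i - t * #|A|%:R.
  rewrite sumrB; congr (_ - _); rewrite -sum1_card natr_sum mulr_sumr [RHS]big_mkcond /=.
  by apply: eq_bigr => i _; case: (i \in A); rewrite ?mulr1.
have ABM : (#|supp f| + #|supp g| <= #|M|.*2)%N.
  apply: card_near_mid.
  - by apply/set0Pn; exists i0.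
  - by apply/set0Pn; exists j0.
  move=> i j m; rewrite !inE => fi gj ijm.
  by apply/existsP; exists i; apply/existsP; exists j; rewrite fi gj.
have hM m : m \in M -> t <= h m.
  rewrite inE => /existsP[i /existsP[j /and3P[fi gj ijm]]].
  by apply: le_trans (fgh _ _ _ ijm); rewrite le_min tf// tg.
have subP u i : 0 <= u i -> (forall j, 0 < u j -> t <= u j) ->
    [/\ 0 <= sub (supp u) u i, 0 < u i -> sub (supp u) u i = u i - t
      & ~~ (0 < u i) -> sub (supp u) u i = 0].
  move=> ui tu; rewrite /sub inE; case: ltP => //= ui0.
    by rewrite mulr1n; split => //; have := tu _ ui0; lra.
  by rewrite mulr0n; split => // *; lra.
have {}IH := IH (sub (supp f) f) (sub (supp g) g) (sub M h) (v - t).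
have : \sum_i sub (supp f) f i + \sum_i sub (supp g) g i <= 2 * \sum_i sub M h i.
  have subv u (u0 : forall i, 0 <= u i) (uv : forall i, u i <= v)
      (tu : forall j, 0 < u j -> t <= u j) i :
      t <= v -> 0 <= sub (supp u) u i <= v - t.
    have [-> S1 S2] := subP _ _ (u0 i) tu => tv /=.
    have [/S1 ->|/S2 ->] := boolP (0 < u i); first by rewrite lerB.
    by rewrite subr_ge0.
  have tv : t <= v by rewrite -fi0 tf// fi0.
  have subM0 m : 0 <= sub M h m.
    rewrite /sub; case: (boolP (m \in M)) => [/hM|_].
      by rewrite mulr1n subr_ge0.
    by rewrite mulr0n subr0.
  apply: IH.
  - rewrite ltnS in lek; apply: leq_trans lek.
    have ssub u : (forall i, 0 <= u i) -> (forall j, 0 < u j -> t <= u j) ->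
        supp (sub (supp u) u) \subset supp u.
      move=> u0 tu; apply/fintype.subsetP => i; rewrite !inE; apply: contraLR => ui.
      by have [_ _ ->] := subP _ _ (u0 i) tu; rewrite ?ltxx.
    have ssubc u c : (forall i, 0 <= u i) -> (forall j, 0 < u j -> t <= u j) ->
        0 < u c -> u c = t -> (#|supp (sub (supp u) u)| < #|supp u|)%N.
      move=> u0 tu uc uct; apply/proper_card/properP; split; first exact: ssub.
      exists c; rewrite !inE//; have [_ -> //] := subP _ _ (u0 c) tu.
      by rewrite uct subrr ltxx.
    have := subset_leq_card (ssub f f0 tf).
    have := subset_leq_card (ssub g g0 tg).
    (* The support that contains the minimiser of value t strictly shrinks. *)
    have [fg|/ltW gf] := leP (f a) (g b).
      by have := ssubc f a f0 tf Aa; rewrite /t (min_idPl fg) => /(_ erefl); lia.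
    by have := ssubc g b g0 tg Bb; rewrite /t (min_idPr gf) => /(_ erefl); lia.
  - by move=> i; have /andP[] := subv f f0 fv tf i tv.
  - by move=> i; have /andP[] := subv g g0 gv tg i tv.
  - exact: subM0.
  - by move=> i; have /andP[] := subv f f0 fv tf i tv.
  - by move=> i; have /andP[] := subv g g0 gv tg i tv.
  - by exists i0; rewrite /sub Ai0 fi0.
  - by exists j0; rewrite /sub Bj0 gj0.
  (* If f i or g j vanishes, the minimum is at most 0; otherwise m lies in M and all three values
     drop by t. *)
  move=> i j m ijm.
  have [fi0' S1 S2] := subP f i (f0 i) tf.
  have [gj0' S3 S4] := subP g j (g0 j) tg.
  have [fi|/S2 ->] := boolP (0 < f i); last by rewrite ge_min subM0.
  have [gj|/S4 ->] := boolP (0 < g j); last by rewrite ge_min subM0 orbT.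
  rewrite S1// S3// /sub (_ : m \in M) ?mulr1n.
    have := fgh _ _ _ ijm; rewrite !ge_min => /orP[] ?; apply/orP; [left|right]; lra.
  by rewrite inE; apply/existsP; exists i; apply/existsP; exists j; rewrite fi gj.
rewrite !sumE; move: ABM; rewrite -(ler_nat R) natrD -mul2n natrM => ABM.
have : t * (#|supp f|%:R + #|supp g|%:R) <= t * (2 * #|M|%:R) by rewrite ler_pM2l.
lra.
Qed.

(** Dividing f and g by their maxima a and b, and h by sqrt(a b), makes both maxima 1; the
    hypothesis on minima then follows from min(u, v)^2 <= u v. AM-GM turns x + y <= 2z into x y <=
    z^2. *)
Lemma prekopa_leindler_nat (R : rcfType) (L : nat) (f g h : 'I_L -> R) :
  (forall i, 0 <= f i) -> (forall i, 0 <= g i) -> (forall i, 0 <= h i) ->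
  (forall i j m : 'I_L, near_mid i j m -> f i * g j <= h m ^+ 2) ->
  (\sum_i f i) * (\sum_i g i) <= (\sum_i h i) ^+ 2.
Proof.
move=> f0 g0 h0 fgh.
have zero_or_max (u : 'I_L -> R) : (forall i, 0 <= u i) ->
    \sum_i u i = 0 \/ exists2 i, 0 < u i & forall j, u j <= u i.
  move=> u0; case: (pselect (exists i, 0 < u i)) => [[i ui]|nu].
    have [j _ jmax] := @arg_maxP _ R _ i predT u isT.
    by right; exists j => [|k]; [exact: lt_le_trans (jmax i isT)|exact: jmax].
  left; rewrite big1 // => i _; apply: le_anti; rewrite u0 andbT leNgt.
  by apply/negP => ui; apply: nu; exists i.
case: (zero_or_max f f0) => [->|[i0 a0 fa]]; first by rewrite mul0r sqr_ge0.
case: (zero_or_max g g0) => [->|[j0 b0 gb]]; first by rewrite mulr0 sqr_ge0.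
set a := f i0 in a0 fa; set b := g j0 in b0 gb.
pose c := Num.sqrt (a * b).
have c0 : 0 < c by rewrite sqrtr_gt0 mulr_gt0.
have cE : c ^+ 2 = a * b by rewrite sqr_sqrtr// mulr_ge0 ?ltW.
have := @prekopa_leindler_min R L (fun i => f i / a) (fun i => g i / b)
  (fun i => h i / c) 1.
rewrite -!mulr_suml; set F := \sum_i f i; set G := \sum_i g i; set H := \sum_i h i.
have F0 : 0 <= F by rewrite sumr_ge0.
have G0 : 0 <= G by rewrite sumr_ge0.
have H0 : 0 <= H by rewrite sumr_ge0.
move=> key; have {key} : F / a + G / b <= 2 * (H / c).
  apply: key => [i|i|i|i|i|||i j m ijm].
  - by rewrite divr_ge0 // ltW.
  - by rewrite divr_ge0 // ltW.
  - by rewrite divr_ge0 // ltW.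
  - by rewrite ler_pdivrMr ?mul1r.
  - by rewrite ler_pdivrMr ?mul1r.
  - by exists i0; rewrite divff ?gt_eqF.
  - by exists j0; rewrite divff ?gt_eqF.
  set u := f i / a; set v := g j / b; set w := h m / c.
  have u0 : 0 <= u by rewrite divr_ge0 // ltW.
  have v0 : 0 <= v by rewrite divr_ge0 // ltW.
  have w0 : 0 <= w by rewrite divr_ge0 // ltW.
  have uvw : u * v <= w ^+ 2.
    rewrite /u /v /w expr_div_n cE mulf_div.
    by rewrite ler_pM2r ?invr_gt0 ?mulr_gt0// fgh.
  rewrite -(@ler_pXn2r _ 2)// ?nnegrE ?le_min ?u0//; apply: le_trans uvw.
  by rewrite expr2 ler_pM ?le_min ?u0 ?ge_min ?lexx ?orbT.
set x := F / a; set y := G / b; set z := H / c => xyz.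
have x0 : 0 <= x by rewrite divr_ge0 // ltW.
have y0 : 0 <= y by rewrite divr_ge0 // ltW.
have : x * y <= z ^+ 2 by have := sqr_ge0 (x - y); nra.
by rewrite /x /y /z expr_div_n cE mulf_div ler_pM2r ?invr_gt0 ?mulr_gt0.
Qed.

(** * Tensorization over boxes *)

Fixpoint boxes (L n : nat) : seq (seq nat) :=
  if n is n'.+1 then [seq a :: s | a <- iota 0 L, s <- boxes L n'] else [:: [::]].

Lemma mem_boxes (L n : nat) (s : seq nat) :
  (s \in boxes L n) = (size s == n) && all (ltn^~ L) s.
Proof.
elim: n s => [|n IH] s; first by rewrite inE; case: s.
apply/allpairsP/andP => [[[a t] [/=]]|].
  by rewrite mem_iota IH /= => aL /andP[/eqP <- tL] ->; rewrite /= aL tL.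
case: s => [|a s] [] //= sn /andP[aL sL]; exists (a, s); split => //=.
  by rewrite mem_iota.
by rewrite IH sL andbT.
Qed.

Lemma boxes_uniq (L n : nat) : uniq (boxes L n).
Proof.
elim: n => // n IH; apply: allpairs_uniq => //; first exact: iota_uniq.
by move=> [a s] [b t] _ _ [-> ->].
Qed.

(** Induction on n: the one-dimensional inequality is applied to the sums over slices of fixed first
    coordinate, and its hypothesis is the induction hypothesis for three slices. *)
Lemma prekopa_leindler_boxes (R : rcfType) (L n : nat) (f g h : seq nat -> R) :
  (forall s, 0 <= f s) -> (forall s, 0 <= g s) -> (forall s, 0 <= h s) ->
  (forall s t r, s \in boxes L n -> t \in boxes L n -> r \in boxes L n ->
     (forall k, (k < n)%N -> near_mid (nth 0%N s k) (nth 0%N t k) (nth 0%N r k)) ->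
     f s * g t <= h r ^+ 2) ->
  (\sum_(s <- boxes L n) f s) * (\sum_(s <- boxes L n) g s) <=
  (\sum_(s <- boxes L n) h s) ^+ 2.
Proof.
elim: n f g h => [|n IH] f g h f0 g0 h0 fgh.
  by rewrite !big_seq1 fgh ?inE.
have sumE (u : seq nat -> R) : \sum_(s <- boxes L n.+1) u s =
    \sum_(a < L) \sum_(s <- boxes L n) u ((a : nat) :: s).
  by rewrite big_allpairs_dep -{1}[L]subn0 -/(index_iota 0 L) big_mkord.
rewrite !sumE; apply: prekopa_leindler_nat => [i|i|i|i j m ijm].
- exact: sumr_ge0.
- exact: sumr_ge0.
- exact: sumr_ge0.
apply: IH => // s t r sB tB rB str; apply: fgh.
- by move: sB; rewrite !mem_boxes /= eqSS ltn_ord.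
- by move: tB; rewrite !mem_boxes /= eqSS ltn_ord.
- by move: rB; rewrite !mem_boxes /= eqSS ltn_ord.
by case=> [|k] //= kn; apply: str.
Qed.

(** * Transfer to the lattice points of bounded sets *)

Section LatticeSums.
Variables (R : realType) (n : nat).
Implicit Types (A : set 'rV[R]_n) (x y z : 'rV[R]_n).

Definition box_bounded (B : nat) A := forall x, A x -> forall i, `|x 0 i| <= B%:R.

(** The shift by B lets the naturals 0, ..., 2B encode the integers -B, ..., B. *)
Definition box_point (B : nat) (s : seq nat) : 'rV[R]_n :=
  \row_i ((nth 0%N s i)%:R - B%:R).

Definition box_list (B : nat) : seq 'rV[R]_n :=
  [seq box_point B s | s <- boxes B.*2.+1 n].

Lemma box_list_uniq B : uniq (box_list B).
Proof.
rewrite map_inj_in_uniq ?boxes_uniq// => s t.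
rewrite !mem_boxes => /andP[/eqP sn _] /andP[/eqP tn _] st.
apply: (@eq_from_nth _ 0%N) => [|i]; first by rewrite sn.
rewrite sn => ni; have := congr1 (fun x : 'rV[R]_n => x 0 (Ordinal ni)) st.
by rewrite !mxE /= => /addIr/eqP; rewrite eqr_nat => /eqP.
Qed.

Lemma mem_box_list B x : integer_points x -> (forall i, `|x 0 i| <= B%:R) ->
  x \in box_list B.
Proof.
move=> xZ xB; pose s := [seq absz (Num.floor (x 0 i + B%:R)) | i <- enum 'I_n].
have xE i : x 0 i = (absz (Num.floor (x 0 i + B%:R)))%:R - B%:R.
  have xi : x 0 i + B%:R \is a Num.int by rewrite rpredD// ?natr_int.
  have x0 : 0 <= x 0 i + B%:R by have := xB i; rewrite ler_norml; lra.
  rewrite natr_absz ger0_norm ?floor_ge0// -[RHS]/(_%:~R - _).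
  by rewrite (floorK xi) addrK.
apply/mapP; exists s.
  rewrite mem_boxes size_map size_enum_ord eqxx /=.
  apply/allP => k /mapP[i _ ->]; rewrite -(ltr_nat R).
  have := xE i; have := xB i; rewrite ler_norml => /andP[_ x1] e.
  have -> : B.*2.+1%:R = B%:R + B%:R + 1 :> R by rewrite -addnn -natr1 natrD.
  lra.
apply/rowP => i; rewrite mxE (nth_map i) ?size_enum_ord//.
by rewrite nth_ord_enum -xE.
Qed.

Lemma box_list_int B x : x \in box_list B -> integer_points x.
Proof. by move=> /mapP[s _ ->] i; rewrite mxE rpredB// natr_int. Qed.

(** Turns sums over a set given by [fset_set] into sums over an explicit list, common to all sets in
    the box. *)
Lemma lattice_points_perm B A : box_bounded B A ->
  perm_eq (lattice_points A) [seq x <- box_list B | x \in A].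
Proof.
move=> AB; have mem x : x \in A `&` @integer_points R n =
    (x \in [seq x <- box_list B | x \in A]).
  rewrite mem_filter; apply/idP/andP; rewrite !inE => -[Ax xZ].
    by split => //; apply: mem_box_list => //; apply: AB.
  by split => //; apply: box_list_int xZ.
have fin : finite_set (A `&` @integer_points R n).
  apply: (sub_finite_set (B := [set` box_list B])); last exact: finite_seq.
  by move=> x [Ax xZ] /=; apply: mem_box_list => //; apply: AB.
apply: uniq_perm; rewrite ?fset_uniq ?filter_uniq ?box_list_uniq// => x.
by rewrite in_fset_set// mem.
Qed.

Lemma mem_lattice_points B A x : box_bounded B A ->
  (x \in lattice_points A) = (x \in A) && (x \in @integer_points R n).
Proof.
move=> AB; rewrite (perm_mem (lattice_points_perm AB)) mem_filter.
case: (boolP (x \in A)) => //=; rewrite inE => Ax; apply/idP/idP.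
  by move/box_list_int; rewrite inE.
by rewrite inE => xZ; apply: mem_box_list => //; apply: AB.
Qed.

(** f and g are extended by 0 outside A, and h outside D; after the shift by B, [near_mid] in a
    coordinate yields |2z - (x + y)| <= 1 there. *)
Lemma prekopa_leindler_lattice B A D (f g h : 'rV[R]_n -> R) :
  box_bounded B A -> box_bounded B D ->
  (forall x, 0 <= f x) -> (forall x, 0 <= g x) -> (forall x, 0 <= h x) ->
  (forall x y z, A x -> A y -> (forall i, `|2 * z 0 i - (x 0 i + y 0 i)| <= 1) ->
     D z /\ f x * g y <= h z ^+ 2) ->
  (\sum_(x <- lattice_points A) f x) * (\sum_(x <- lattice_points A) g x) <=
  (\sum_(z <- lattice_points D) h z) ^+ 2.
Proof.
move=> AB DB f0 g0 h0 fgh.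
have sumE E (EB : box_bounded B E) (u : 'rV[R]_n -> R) : \sum_(x <- lattice_points E) u x =
    \sum_(s <- boxes B.*2.+1 n) if box_point B s \in E then u (box_point B s) else 0.
  by rewrite (perm_big _ (lattice_points_perm EB)) big_filter big_map big_mkcond.
rewrite !(sumE A)// (sumE D)//.
apply: prekopa_leindler_boxes => [s|s|s|s t r sB tB rB str].
- by case: ifP.
- by case: ifP.
- by case: ifP.
case: ifPn => [|_]; last by rewrite mul0r; apply: sqr_ge0.
rewrite inE => As; case: ifPn => [|_]; last by rewrite mulr0; apply: sqr_ge0.
rewrite inE => At.
have [i|Dr fg] := fgh _ _ (box_point B r) As At; last by rewrite mem_set.
have /andP[le1 le2] := str i (ltn_ord i).
have dblE m : m.*2%:R = m%:R + m%:R :> R by rewrite -addnn natrD.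
move: le1; rewrite -(ler_nat R) -natr1 dblE natrD => le1.
move: le2; rewrite -(ler_nat R) -natr1 dblE natrD => le2.
by rewrite !mxE ler_norml; apply/andP; split; lra.
Qed.

End LatticeSums.

(** * Geometry of K + C_n *)

Section Body.
Variables (R : realType) (n : nat).
Implicit Types (K A D : set 'rV[R]_n.+1) (x y z : 'rV[R]_n.+1).

Local Notation cube_sum K := (minkowski_sum K (@open_cube R n.+1)).

Definition height x : R := `|x 0 ord_max|.

Lemma inner_last_basis x : inner x (last_basis R n) = x 0 ord_max.
Proof.
rewrite /inner (bigD1 ord_max) //= big1 => [|i ni].
  by rewrite mxE !eqxx mulr1 addr0.
by rewrite mxE (negbTE ni) andbF mulr0.
Qed.

Lemma convex_set_comb K (t : R) x y : convex_set K -> K x -> K y ->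
  0 <= t -> t <= 1 -> K (t *: x + (1 - t) *: y).
Proof.
move=> cK Kx Ky t0 t1.
have := cK x y (Itv01 t0 t1); rewrite !inE => /(_ Kx Ky).
by [].
Qed.

Lemma last_basis_ball : euclidean_ball (last_basis R n).
Proof.
by rewrite /euclidean_ball /= inner_last_basis mxE !eqxx sqrtr1.
Qed.

Lemma height_last_basis : height (last_basis R n) = 1.
Proof. by rewrite /height mxE !eqxx normr1. Qed.

Lemma last_basis_int : integer_points (last_basis R n).
Proof. by move=> i; rewrite mxE natr_int. Qed.

Lemma height_ge1 x : integer_points x -> height x != 0 -> 1 <= height x.
Proof. by move=> xZ; rewrite normr_eq0; apply: norm_intr_ge1. Qed.

Lemma height0_eq0 x : height x = 0 -> x 0 ord_max = 0.
Proof. by move/eqP; rewrite normr_eq0 => /eqP. Qed.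

Lemma sub_cube_sum K : K `<=` cube_sum K.
Proof.
move=> x Kx; exists x => //; exists 0; last by rewrite addr0.
by move=> i; rewrite mxE ltrN10 ltr01.
Qed.

(** z differs from the midpoint of x and y, a point of K, by at most 1/2 < 1 in each coordinate. *)
Lemma near_midpoint_cube_sum K x y z : convex_set K -> K x -> K y ->
  (forall i, `|2 * z 0 i - (x 0 i + y 0 i)| <= 1) -> (cube_sum K) z.
Proof.
move=> cK Kx Ky zxy.
pose m : 'rV[R]_n.+1 := 2^-1 *: x + (1 - 2^-1) *: y.
exists m; first by apply: convex_set_comb => //; lra.
exists (z - m); last by rewrite addrC subrK.
move=> i; have := zxy i; rewrite /m !mxE ler_norml => /andP[? ?].
by apply/andP; split; lra.
Qed.

(** Write y = k + u with u in the open cube. A shift by e_n against the sign of u_n keeps u in the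
    cube; if u_n = 0, k is moved towards e_n instead. *)
Lemma cube_sum_step K y : convex_set K -> @euclidean_ball R n.+1 `<=` K ->
  (cube_sum K) y -> y 0 ord_max = 0 ->
  (cube_sum K) (y + last_basis R n) \/ (cube_sum K) (y - last_basis R n).
Proof.
move=> cK ballK [k Kk [u uC yE]] y0.
have kE : k 0 ord_max = - u 0 ord_max.
  by move: y0; rewrite -yE mxE => /eqP; rewrite addr_eq0 => /eqP.
have eE i : last_basis R n 0 i = (i == ord_max)%:R by rewrite mxE.
have [ult|ugt|u0] := ltgtP (u 0 ord_max) 0.
- left; exists k => //; exists (u + last_basis R n); last by rewrite -yE addrA.
  move=> i; rewrite mxE eE; have := uC i.
  have [->|_] := eqVneq i ord_max; last by rewrite addr0.
  by move=> /andP[? ?]; apply/andP; split; rewrite /=; lra.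
- right; exists k => //; exists (u - last_basis R n); last by rewrite -yE addrA.
  move=> i; rewrite mxE [X in _ + X]mxE eE; have := uC i.
  have [->|_] := eqVneq i ord_max; last by rewrite oppr0 addr0.
  by move=> /andP[? ?]; apply/andP; split; rewrite /=; lra.
left.
(* u_n = 0: replace k by a point of the segment [k, e_n] close to k *)
pose d : R := \big[Num.max/0]_i `|u 0 i|.
have ud i : `|u 0 i| <= d by apply: (le_bigmax _ (fun i => `|u 0 i|)).
have d1 : d < 1.
  apply/bigmax_ltP; split=> // i _; have := uC i; by rewrite ltr_norml.
pose b : R := \big[Num.max/0]_i `|k 0 i|.
have kb i : `|k 0 i| <= b by apply: (le_bigmax _ (fun i => `|k 0 i|)).
have b0 : 0 <= b by apply: le_trans (kb ord_max).
have d0 : 0 <= d by apply: le_trans (ud ord_max).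
(* The new remainder is u + t k + (1 - t) e_n. This t gives d + t b < 1 for the first coordinates,
   and the last one is 1 - t < 1. *)
pose t := (1 - d) / (2 * (b + 1)).
have b1 : 0 < 2 * (b + 1) by lra.
have tb : 2 * t + 2 * (t * b) = 1 - d.
  by rewrite -[RHS](@mulfVK _ (2 * (b + 1))) ?gt_eqF// -/t; ring.
have t0 : 0 < t by rewrite divr_gt0// subr_gt0.
have tb0 : 0 <= t * b by rewrite mulr_ge0// ltW.
have t1 : t <= 1 by lra.
clearbody t; pose k' : 'rV[R]_n.+1 := t *: last_basis R n + (1 - t) *: k.
exists k'; first by apply: convex_set_comb; rewrite ?(ltW t0)//; exact/ballK/last_basis_ball.
exists (y + last_basis R n - k'); last by rewrite addrC subrK.
move=> i; rewrite -yE /k' !mxE eqxx /=.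
have [->|_] := eqVneq i ord_max.
  by rewrite kE u0 oppr0; apply/andP; split; rewrite /=; lra.
rewrite /= mulr0n.
have : `|t * k 0 i| <= t * b by rewrite normrM (ger0_norm (ltW t0)) ler_wpM2l ?kb ?(ltW t0).
have := ud i; rewrite !ler_norml => /andP[? ?] /andP[? ?].
by apply/andP; split; lra.
Qed.

End Body.

(** * Moments of the height and the reverse Hoelder inequality *)

Section Moments.
Variables (R : realType) (n : nat).
Implicit Types (K A D : set 'rV[R]_n.+1) (x y z : 'rV[R]_n.+1).

Local Notation cube_sum K := (minkowski_sum K (@open_cube R n.+1)).

Definition height_sum A (p : R) : R := \sum_(x <- lattice_points A) height x `^ p.

Lemma sum_one_lattice A : \sum_(x <- lattice_points A) (1 : R) = (lattice_count A)%:R.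
Proof.
by rewrite big_const_seq count_predT iter_addr_0.
Qed.

Lemma ler_sum_lattice B A D (f : 'rV[R]_n.+1 -> R) :
  A `<=` D -> box_bounded B D -> (forall x, 0 <= f x) ->
  \sum_(x <- lattice_points A) f x <= \sum_(x <- lattice_points D) f x.
Proof.
move=> AD DB f0; have AB : box_bounded B A by move=> x /AD; apply: DB.
rewrite !(perm_big _ (lattice_points_perm AB)) !(perm_big _ (lattice_points_perm DB)) /=.
rewrite !big_filter big_mkcond [leRHS]big_mkcond /=; apply: ler_sum => x _.
case: ifPn => [|_]; last by case: ifP.
by rewrite inE => /AD /mem_set ->.
Qed.

Lemma last_basis_lattice B A : box_bounded B A -> A (last_basis R n) ->
  last_basis R n \in lattice_points A.
Proof.
move=> AB Ae; rewrite (mem_lattice_points _ AB); apply/andP; split; rewrite inE//.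
exact: last_basis_int.
Qed.

Lemma height_sum_ge1 B A (p : R) : box_bounded B A -> A (last_basis R n) ->
  1 <= height_sum A p.
Proof.
move=> AB Ae; rewrite /height_sum (big_rem _ (last_basis_lattice AB Ae)) /=.
by rewrite height_last_basis powR1 lerDl sumr_ge0// => x _; rewrite powR_ge0.
Qed.

Lemma lattice_count_gt0 B A : box_bounded B A -> A (last_basis R n) ->
  0 < (lattice_count A)%:R :> R.
Proof.
move=> AB Ae; rewrite -sum_one_lattice (big_rem _ (last_basis_lattice AB Ae)) /=.
by rewrite ltr_pwDl// sumr_ge0.
Qed.

(* By cube_sum_step, adding e_n or -e_n maps the points of height 0 injectively
   to points of height 1. *)
Lemma height_sum_slab B K (p : R) : convex_set K -> @euclidean_ball R n.+1 `<=` K ->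
  box_bounded B (cube_sum K) ->
  \sum_(y <- lattice_points (cube_sum K)) (height y == 0)%R%:R <=
  height_sum (cube_sum K) p.
Proof.
move=> cK ballK DB; set P := lattice_points _.
have inP y : y \in P -> cube_sum K y /\ integer_points y.
  by rewrite (mem_lattice_points _ DB) => /andP[]; rewrite !inE.
pose phi y := if y + last_basis R n \in cube_sum K then y + last_basis R n
  else y - last_basis R n.
have eE : last_basis R n 0 ord_max = 1 by rewrite mxE !eqxx.
(* The last coordinate of phi y is 1 or -1 according to the shift used, which makes phi injective on
   the slab. *)
have phiE y : height y = 0 -> (phi y) 0 ord_max = (-1) ^+ (y + last_basis R n \notin cube_sum K).
  by move=> /height0_eq0 y0; rewrite /phi; case: ifP => _; rewrite !mxE y0 !eqxx add0r.
pose s1 := [seq phi y | y <- [seq y <- P | height y == 0]].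
pose s2 := [seq y <- P | height y == 1].
have le12 : (size s1 <= size s2)%N.
  apply: uniq_leq_size.
    rewrite map_inj_in_uniq ?filter_uniq ?fset_uniq// => x y.
    rewrite !mem_filter => /andP[/eqP x0 _] /andP[/eqP y0 _] xy.
    have := congr1 (fun z => z 0 ord_max) xy; rewrite phiE// phiE// => /eqP.
    rewrite (inj_eq (@signr_inj _)) => /eqP/negb_inj e.
    by move: xy; rewrite /phi e; case: ifP => _ => [/addIr|/addIr].
  move=> z /mapP[y]; rewrite mem_filter => /andP[/eqP y0 yP] ->.
  rewrite mem_filter {1}/height phiE// normr_sign eqxx /=.
  have [yD yZ] := inP y yP.
  rewrite (mem_lattice_points _ DB); apply/andP; split; rewrite inE.
    rewrite /phi; case: ifPn; rewrite ?inE// => /negP; rewrite inE => ny.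
    by have [] := cube_sum_step cK ballK yD; first exact: height0_eq0.
  move=> i; rewrite /phi; case: ifP => _; rewrite mxE rpredD ?yZ ?rpredN //.
    exact: last_basis_int.
  by rewrite mxE rpredN; exact: last_basis_int.
apply: (@le_trans _ _ (size s2)%:R).
  rewrite -natr_sum ler_nat (leq_trans _ le12)// size_map size_filter.
  by rewrite -sum1_count [leqRHS]big_mkcond /= leq_sum// => y _; case: eqP.
rewrite size_filter -sum1_count natr_sum big_mkcond /=; apply: ler_sum => y _.
by case: eqP => [->|_]; rewrite ?powR1 ?powR_ge0.
Qed.

(** Absorbs the rounding error 1: a nonzero height h is at least 1, so h + 1 <= 2h, while the points
    of height 0 contribute 1 each and are paid for by [height_sum_slab]. Finally 2^p + 1 <= 4^p. *)
Lemma height_sum_succ B K (p : R) : convex_set K -> @euclidean_ball R n.+1 `<=` K ->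
  box_bounded B (cube_sum K) -> 1 <= p ->
  \sum_(y <- lattice_points (cube_sum K)) (height y + 1) `^ p <=
  4 `^ p * height_sum (cube_sum K) p.
Proof.
move=> cK ballK DB p1; have p0 : 0 <= p by lra.
set S := height_sum _ p.
have S0 : 0 <= S by apply: sumr_ge0 => *; rewrite powR_ge0.
have slab := height_sum_slab p cK ballK DB.
have pt y : y \in lattice_points (cube_sum K) ->
    (height y + 1) `^ p <= 2 `^ p * height y `^ p + (height y == 0)%R%:R.
  rewrite (mem_lattice_points _ DB) => /andP[_]; rewrite inE => yZ.
  have [->|y0] := eqVneq (height y) 0.
    by rewrite add0r powR1 lerDr mulr_ge0 ?powR_ge0.
  have y1 := height_ge1 yZ y0.
  rewrite addr0 -powRM; [|lra|lra].
  by apply: ge0_ler_powR; rewrite ?nnegrE; lra.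
apply: (@le_trans _ _ (2 `^ p * S + S)).
  apply: (@le_trans _ _ (2 `^ p * S +
      \sum_(y <- lattice_points (cube_sum K)) (height y == 0)%R%:R)).
    by rewrite /S /height_sum mulr_sumr -big_split /= big_seq [leRHS]big_seq ler_sum.
  by rewrite lerD2l.
have -> : 4 = 2 * 2 :> R by lra.
rewrite powRM//; have : 2 <= 2 `^ p :> R by apply: le1r_powR; lra.
move: (2 `^ p) => t t2.
by rewrite -{2}[S]mul1r -mulrDl ler_wpM2r//; nra.
Qed.

(* Half of the lattice points x' of K have height at most M; averaging such a
   point with a point x of height > 2M gives a point of K + C_n of height at
   least |x_n|/4 - 1/2, and the discrete Prekopa-Leindler inequality applies. *)
Lemma height_reverse_hoelder B K (p : R) :
  convex_set K -> @euclidean_ball R n.+1 `<=` K ->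
  box_bounded B (cube_sum K) -> 1 <= p ->
  (\sum_(x <- lattice_points K) (height x `^ p) ^+ 2) * (lattice_count K)%:R <=
  (32 `^ p * height_sum (cube_sum K) p) ^+ 2.
Proof.
move=> cK ballK DB p1; have p0 : 0 < p by lra.
have KB : box_bounded B K by move=> x /sub_cube_sum; apply: DB.
set S := height_sum _ p; set G : R := (lattice_count K)%:R.
have G0 : 0 <= G by rewrite ler0n.
have S0 : 0 <= S by apply: sumr_ge0 => *; rewrite powR_ge0.
have Ke : K (last_basis R n) by exact/ballK/last_basis_ball.
have Ggt0 : 0 < G by apply: lattice_count_gt0 KB Ke.
have Sgt0 : 0 < S by apply: lt_le_trans (height_sum_ge1 p DB (sub_cube_sum Ke)).
(* Since M^p = 2^p S/G >= 2 S/G, Markov's inequality leaves at least half of the lattice points of K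
   at height at most M. *)
pose M := 2 * (S / G) `^ p^-1.
have SG0 : 0 <= S / G by rewrite divr_ge0.
have M0 : 0 <= M by rewrite mulr_ge0 ?powR_ge0.
have MpE : M `^ p = 2 `^ p * (S / G).
  by rewrite powRM ?powR_ge0// -powRrM mulVf ?gt_eqF// powRr1.
have t2 : 2 <= 2 `^ p :> R by apply: le1r_powR; lra.
have low : G <= 2 * \sum_(x <- lattice_points K) (height x <= M)%R%:R.
  have : \sum_(x <- lattice_points K) ((1 - (height x <= M)%R%:R) * (M `^ p)) <= S.
    apply: (@le_trans _ _ (height_sum K p)).
      apply: ler_sum => x _; have [xM|Mx] := leP (height x) M.
        by rewrite subrr mul0r powR_ge0.
      rewrite subr0 mul1r; apply: ge0_ler_powR;
        by rewrite ?nnegrE ?normr_ge0 ?M0 ?(ltW Mx) ?(ltW p0).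
    apply: (@ler_sum_lattice B K _ (fun x => height x `^ p)) => //; first exact: sub_cube_sum.
    by move=> x; rewrite powR_ge0.
  rewrite -mulr_suml sumrB sum_one_lattice -/G MpE.
  set g := \sum_(_ <- _) _ => le.
  have : (G - g) * 2 * (S / G) <= G * (S / G).
    have -> : G * (S / G) = S by rewrite mulrC mulfVK ?gt_eqF.
    have [Gg|/ltW Gg] := leP 0 (G - g); last first.
      by apply: le_trans (ltW Sgt0); rewrite -mulrA; apply: mulr_le0_ge0 => //; exact: mulr_ge0.
    by apply: le_trans le; rewrite -mulrA ler_wpM2l// ler_wpM2r.
  by rewrite ler_pM2r ?divr_gt0//; lra.
(* For |x_n| > 2M and |y_n| <= M, the bound |x_n| <= |y_n| + 2|z_n| + 1 yields |x_n| <= 4(|z_n| +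
   1). This 4^p and the one from [height_sum_succ] make 16^p. *)
have high : (\sum_(x <- lattice_points K)
      (if 2 * M < height x then (height x `^ p) ^+ 2 else 0)) *
    \sum_(x <- lattice_points K) (height x <= M)%R%:R <= (16 `^ p * S) ^+ 2.
  apply: (@le_trans _ _ ((\sum_(z <- lattice_points (cube_sum K))
      4 `^ p * (height z + 1) `^ p) ^+ 2)).
    apply: (prekopa_leindler_lattice KB DB) => [x|x|x|x y z Kx Ky zxy].
    - by case: ifP; rewrite ?sqr_ge0.
    - by rewrite ler0n.
    - by rewrite mulr_ge0 ?powR_ge0.
    split; first exact: near_midpoint_cube_sum zxy.
    case: ifPn => [Mx|_]; last by rewrite mul0r sqr_ge0.
    have [yM|_] := leP (height y) M; last by rewrite mulr0 sqr_ge0.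
    rewrite mulr1 ler_sqr ?nnegrE ?mulr_ge0 ?powR_ge0//.
    rewrite -powRM ?addr_ge0 ?normr_ge0//; apply: ge0_ler_powR;
      rewrite ?nnegrE ?mulr_ge0 ?addr_ge0 ?normr_ge0 ?(ltW p0)//.
    have : height x <= height y + 2 * height z + 1.
      have abs (r : R) : - `|r| <= r <= `|r| by rewrite -ler_norml.
      have /andP[y1 y2] := abs (y 0 ord_max); have /andP[z1 z2] := abs (z 0 ord_max).
      have := zxy ord_max; rewrite ler_norml => /andP[w1 w2].
      by rewrite ler_norml /height; apply/andP; split; lra.
    by lra.
  rewrite ler_sqr ?nnegrE ?mulr_ge0 ?powR_ge0//; last first.
    by apply: sumr_ge0 => *; rewrite mulr_ge0 ?powR_ge0.
  rewrite -mulr_sumr; have -> : 16 = 4 * 4 :> R by lra.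
  rewrite powRM// -mulrA ler_wpM2l ?powR_ge0//.
  exact: height_sum_succ cK ballK DB p1.
(* Points of height at most 2M are bounded termwise, with (2M)^p G = 4^p S. *)
have mid : (\sum_(x <- lattice_points K)
      (if 2 * M < height x then 0 else (height x `^ p) ^+ 2)) * G
    <= (4 `^ p * S) ^+ 2.
  have -> : (4 `^ p * S) ^+ 2 = ((2 * M) `^ p) ^+ 2 * G * G.
    rewrite powRM// MpE; have -> : 4 = 2 * 2 :> R by lra.
    by rewrite powRM//; field; rewrite gt_eqF.
  rewrite ler_wpM2r// /G -sum_one_lattice mulr_sumr; apply: ler_sum => x _.
  rewrite mulr1; case: ltP => xM; rewrite ?sqr_ge0//.
  have M2 : 0 <= 2 * M by rewrite mulr_ge0.
  rewrite ler_sqr ?nnegrE ?powR_ge0//; apply: ge0_ler_powR;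
    by rewrite ?nnegrE ?normr_ge0 ?M2 ?xM ?(ltW p0).
set Hi := (X in X * _ <= _) in high; set g := \sum_(_ <- _) _ in low high.
set Lo := (X in X * _ <= _) in mid.
have -> : \sum_(x <- lattice_points K) height x `^ p ^+ 2 = Hi + Lo.
  rewrite -big_split /=; apply: eq_bigr => x _.
  by case: ifP; rewrite ?addr0 ?add0r.
have Hi0 : 0 <= Hi by apply: sumr_ge0 => x _; case: ifP; rewrite ?sqr_ge0.
have -> : 32 `^ p = 2 `^ p * (2 `^ p * (2 `^ p * (2 `^ p * 2 `^ p))) :> R.
  by rewrite -!powRM//; congr (_ `^ _); lra.
have e4 : 4 `^ p = 2 `^ p * 2 `^ p :> R by rewrite -powRM//; congr (_ `^ _); lra.
have e16 : 16 `^ p = 2 `^ p * (2 `^ p * (2 `^ p * 2 `^ p)) :> R.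
  by rewrite -!powRM//; congr (_ `^ _); lra.
(* With t = 2^p >= 2 and u = (16^p S)^2: Hi G <= 2u and Lo G <= (4^p S)^2 <= u, while 3u <= t^2 u =
   (32^p S)^2. *)
move: high mid; rewrite e4 e16; move: (2 `^ p) t2 => t t2 high mid.
have HiG : Hi * G <= Hi * (2 * g) by rewrite ler_wpM2l.
set u := (_ * S) ^+ 2 in high; have u0 : 0 <= u by rewrite sqr_ge0.
have tt : 4 <= t * t by nra.
have tu : (t * t * S) ^+ 2 <= u.
  have -> : u = (t * t) ^+ 2 * (t * t * S) ^+ 2 by rewrite /u; ring.
  by rewrite ler_peMl ?sqr_ge0// exprn_ege1 //; lra.
have -> : (t * (t * (t * (t * t))) * S) ^+ 2 = t ^+ 2 * u by rewrite /u; ring.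
have : 4 * u <= t ^+ 2 * u by rewrite ler_wpM2r// expr2.
lra.
Qed.

End Moments.

(** * Bounds on D_0 and D_q *)

Section D0Bounds.
Variables (R : realType) (n : nat).
Implicit Types (K A L : set 'rV[R]_n.+1) (x y z : 'rV[R]_n.+1) (p q : R).

Local Notation cube_sum K := (minkowski_sum K (@open_cube R n.+1)).

Lemma last_momentE A p :
  last_moment A p = (height_sum A p / (lattice_count A)%:R) `^ p^-1.
Proof.
rewrite /last_moment /lattice_mean /height_sum; congr ((_ / _) `^ _).
by apply: eq_bigr => x _; rewrite inner_last_basis.
Qed.

Lemma height_sum_ge0 A p : 0 <= height_sum A p.
Proof. by apply: sumr_ge0 => x _; rewrite powR_ge0. Qed.

(** The ratio of counts in D_0 changes the normalisation of the moment over L + C_n from G_n(L +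
    C_n) to G_n(L). *)
Lemma D0E B L p : box_bounded B (cube_sum L) -> L (last_basis R n) ->
  D0 L p = (1 + (height_sum (cube_sum L) p / (lattice_count L)%:R) `^ p^-1)
           / (height_sum L p / (lattice_count L)%:R) `^ p^-1.
Proof.
move=> LB Le; rewrite /D0 !last_momentE -powRM ?divr_ge0 ?height_sum_ge0//.
rewrite mulrA mulfVK// gt_eqF//.
exact: lattice_count_gt0 LB (sub_cube_sum Le).
Qed.

Lemma lattice_count_le B A : box_bounded B A ->
  (lattice_count A <= size (box_list R n.+1 B))%N.
Proof.
move=> AB; rewrite /lattice_count (perm_size (lattice_points_perm AB)).
by rewrite size_filter count_size.
Qed.

(** A crude bound uniform in p, used to bound the set whose supremum is [Dq]. The box has m lattice
    points, so the moment in the numerator is at most m B; e_n in L makes the denominator at least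
    1/m. *)
Lemma D0_le B L p : box_bounded B (cube_sum L) -> L (last_basis R n) -> 1 <= p ->
  D0 L p <= (1 + (size (box_list R n.+1 B))%:R * B%:R) *
            (size (box_list R n.+1 B))%:R.
Proof.
move=> DB Le p1; set m : R := (size _)%:R; have p0 : 0 < p by lra.
have pV1 : p^-1 <= 1 by rewrite invf_le1.
have pV0 : 0 <= p^-1 by rewrite invr_ge0 ltW.
have LB : box_bounded B L by move=> x /sub_cube_sum; apply: DB.
rewrite (D0E p DB Le).
have Gm : (lattice_count L)%:R <= m by rewrite ler_nat lattice_count_le.
have Dm : (lattice_count (cube_sum L))%:R <= m by rewrite ler_nat lattice_count_le.
set G : R := (lattice_count L)%:R in Gm *.
have G1 : 1 <= G by rewrite ler1n -(ltr_nat R) (lattice_count_gt0 LB Le).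
have G0 : 0 <= G by lra.
have m1 : 1 <= m by exact: le_trans Gm.
have m0 : 0 < m by lra.
have num : (height_sum (cube_sum L) p / G) `^ p^-1 <= m * B%:R.
  apply: (@le_trans _ _ ((m * B%:R `^ p) `^ p^-1)).
    have le : height_sum (cube_sum L) p <= m * B%:R `^ p.
      apply: (@le_trans _ _ ((lattice_count (cube_sum L))%:R * B%:R `^ p)).
        rewrite -sum_one_lattice mulr_suml /height_sum big_seq [leRHS]big_seq.
        apply: ler_sum => x; rewrite (mem_lattice_points _ DB) => /andP[]; rewrite inE => Dx _.
        rewrite mul1r; apply: ge0_ler_powR; rewrite ?nnegrE ?normr_ge0 ?(ltW p0)//.
        exact: DB.
      by rewrite ler_wpM2r ?powR_ge0.
    have SG : height_sum (cube_sum L) p / G <= height_sum (cube_sum L) p.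
      by rewrite ler_pdivrMr ?ler_peMr ?height_sum_ge0//; lra.
    apply: ge0_ler_powR; rewrite ?nnegrE ?divr_ge0 ?height_sum_ge0 ?mulr_ge0 ?powR_ge0//.
    exact: le_trans SG le.
  rewrite powRM ?powR_ge0 ?(ltW m0)// -powRrM divff ?gt_eqF// powRr1//.
  by rewrite ler_wpM2r// ler1_powR.
have den : m^-1 <= (height_sum L p / G) `^ p^-1.
  have mV : 0 < m^-1 <= 1 by rewrite invr_gt0 m0 invf_le1.
  apply: le_trans (ger1_powR mV pV1) _.
  apply: ge0_ler_powR; rewrite ?nnegrE ?divr_ge0 ?invr_ge0 ?height_sum_ge0 ?(ltW m0) ?(ltW p0)//.
  apply: (@le_trans _ _ G^-1); first by rewrite lef_pV2 ?posrE//; lra.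
  by rewrite ler_peMl ?invr_ge0// (height_sum_ge1 p LB Le).
have den0 : 0 < (height_sum L p / G) `^ p^-1.
  by apply: lt_le_trans den; rewrite invr_gt0.
rewrite ler_pdivrMr// -mulrA.
set d := (_ `^ _) in den den0 *; set a := (_ `^ _) in num *.
have md : 1 <= m * d by rewrite mulrC -ler_pdivrMr// mul1r.
have a0 : 0 <= m * B%:R by rewrite mulr_ge0// ltW.
apply: (@le_trans _ _ (1 + m * B%:R)); first by rewrite lerD2l.
by rewrite ler_peMr//; lra.
Qed.

Lemma mx_image1 K : mx_image 1%:M K = K.
Proof.
apply/seteqP; split => [_ [x Kx <-]|x Kx]; first by rewrite trmx1 mulmx1.
by exists x; rewrite ?trmx1 ?mulmx1.
Qed.

Lemma innerE (k : nat) (x y : 'rV[R]_k) : inner x y = (x *m y^T) 0 0.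
Proof. by rewrite /inner mxE; apply: eq_bigr => i _; rewrite mxE. Qed.

(** e_n is the image under U of U^T e_n, a unit vector and hence a point of K. *)
Lemma last_basis_mx_image K (U : 'M[R]_n.+1) : orthogonal_group U ->
  @euclidean_ball R n.+1 `<=` K -> mx_image U K (last_basis R n).
Proof.
rewrite /orthogonal_group /= => UU ballK.
exists (last_basis R n *m U); last by rewrite -mulmxA UU mulmx1.
apply: ballK; rewrite /euclidean_ball /= innerE trmx_mul mulmxA -(mulmxA _ U) UU mulmx1.
by rewrite -innerE inner_last_basis mxE !eqxx sqrtr1.
Qed.

Lemma orthogonal_entry_le1 (U : 'M[R]_n.+1) i j : orthogonal_group U -> `|U i j| <= 1.
Proof.
rewrite /orthogonal_group /= => UU.
have : \sum_k U i k ^+ 2 = 1.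
  have <- : (U *m U^T) i i = 1 by rewrite UU mxE eqxx.
  rewrite mxE.
  by apply: eq_bigr => k _; rewrite mxE expr2.
rewrite (bigD1 j) //= => e.
have : 0 <= \sum_(k | k != j) U i k ^+ 2 by apply: sumr_ge0 => k _; rewrite sqr_ge0.
move=> e0; rewrite -(@ler_sqr R) ?nnegrE// expr1n real_normK ?num_real//; lra.
Qed.

Lemma mx_image_cube_bounded B K (U : 'M[R]_n.+1) : orthogonal_group U ->
  box_bounded B K -> box_bounded (n.+1 * B).+1 (cube_sum (mx_image U K)).
Proof.
move=> OU KB _ [_ [x Kx <-] [u uC <-]] i.
rewrite -natr1 natrM mxE; apply: le_trans (ler_normD _ _) _; apply: lerD.
  rewrite mxE; apply: le_trans (ler_norm_sum _ _ _) _.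
  have -> : n.+1%:R * B%:R = \sum_(j < n.+1) B%:R :> R.
    by rewrite sumr_const card_ord mulr_natl.
  apply: ler_sum => j _; rewrite mxE normrM -[leRHS]mulr1 ler_pM ?KB//.
  exact: orthogonal_entry_le1.
by have := uC i; rewrite ler_norml => /andP[/ltW -> /ltW ->].
Qed.

Lemma cube_sum_bounded B K : box_bounded B K ->
  box_bounded (n.+1 * B).+1 (cube_sum K).
Proof.
rewrite -{2}[K]mx_image1; apply: mx_image_cube_bounded.
by rewrite /orthogonal_group /= trmx1 mulmx1.
Qed.

Lemma compact_box_bounded K : compact K -> exists B, box_bounded B K.
Proof.
move=> /compact_bounded[M [Mreal KM]].
exists (Num.truncn (M + 1)).+1 => x Kx i.
apply: le_trans (ltW (truncnS_gt (M + 1))).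
apply: (@le_trans _ _ `|x|); last by apply: KM => //; rewrite ltrDl.
by rewrite [leRHS]/Num.Def.normr /= mx_normrE; apply/bigmax_geP; right => /=; exists (0, i).
Qed.

(** U = 1 places D_0(K, p) in the set. The supremum bounds it because the set is bounded above: all
    sums U K + C_n lie in one box, whatever U. *)
Lemma Dq_ge_D0 K p q : convex_body K -> @euclidean_ball R n.+1 `<=` K ->
  1 <= p <= q -> D0 K p <= Dq K q.
Proof.
move=> [cK _ _] ballK pq; have [B KB] := compact_box_bounded cK.
apply: ub_le_sup.
  pose m : R := (size (box_list R n.+1 (n.+1 * B).+1))%:R.
  exists ((1 + m * (n.+1 * B).+1%:R) * m) => _ [U [r [OU /andP[r1 _] ->]]].
  apply: D0_le => //; first exact: mx_image_cube_bounded.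
  exact: last_basis_mx_image.
exists 1%:M, p; split => //; last by rewrite mx_image1.
by rewrite /orthogonal_group /= trmx1 mulmx1.
Qed.

(** With s and S the sums over K and K + C_n, D_0 <= D reads 1 + (S/G)^(1/p) <= D (s/G)^(1/p).
    Dropping the 1 gives the second claim; s <= S gives D >= 1. *)
Lemma moment_cube_le_Dq K p q : convex_body K -> @euclidean_ball R n.+1 `<=` K ->
  1 <= p <= q ->
  1 <= Dq K q /\
  height_sum (cube_sum K) p <= (Dq K q) `^ p * height_sum K p.
Proof.
move=> cK ballK pq; have := Dq_ge_D0 cK ballK pq.
have [/compact_box_bounded[B0 KB0] _ _] := cK.
have Ke : K (last_basis R n) by exact/ballK/last_basis_ball.
have DB := cube_sum_bounded KB0.
have KB : box_bounded (n.+1 * B0).+1 K by move=> x /sub_cube_sum; apply: DB.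
have /andP[p1 _] := pq; have p0 : 0 < p by lra.
have SKS : height_sum K p <= height_sum (cube_sum K) p.
  apply: (@ler_sum_lattice _ _ _ _ _ (fun x => height x `^ p)) DB _; first exact: sub_cube_sum.
  by move=> x; rewrite powR_ge0.
rewrite (D0E p DB Ke); have G0 := lattice_count_gt0 KB Ke.
set G : R := (lattice_count K)%:R in G0 *.
set S := height_sum (cube_sum K) p in SKS *; set s := height_sum K p in SKS *.
have s0 : 0 < s by apply: lt_le_trans (height_sum_ge1 p KB Ke).
have S0 : 0 < S by apply: lt_le_trans SKS.
have rootK (t : R) : 0 <= t -> (t `^ p^-1) `^ p = t.
  by move=> t0; rewrite -powRrM mulVf ?gt_eqF// powRr1.
set D := Dq K q; rewrite ler_pdivrMr ?powR_gt0 ?divr_gt0// => le.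
have a0 : 0 < (s / G) `^ p^-1 by rewrite powR_gt0// divr_gt0.
have ab : (s / G) `^ p^-1 <= (S / G) `^ p^-1.
  apply: ge0_ler_powR;
    rewrite ?nnegrE ?invr_ge0 ?(ltW p0) ?divr_ge0 ?(ltW s0) ?(ltW S0) ?(ltW G0)//.
  by rewrite ler_wpM2r ?invr_ge0 ?(ltW G0).
have D1 : 1 <= D by rewrite -(ler_pM2r a0) mul1r; lra.
split => //.
have {}le : (S / G) `^ p^-1 <= D * (s / G) `^ p^-1 by lra.
have : ((S / G) `^ p^-1) `^ p <= (D * (s / G) `^ p^-1) `^ p.
  by apply: ge0_ler_powR; rewrite ?nnegrE ?powR_ge0 ?(ltW p0) ?mulr_ge0 ?powR_ge0//; lra.
have D0' : 0 <= D by lra.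
have sG : 0 <= s / G by rewrite divr_ge0 ?ltW.
have SG : 0 <= S / G by rewrite divr_ge0 ?ltW.
by rewrite (powRM p D0' (powR_ge0 _ _)) (rootK _ SG) (rootK _ sG) mulrA ler_pM2r ?invr_gt0.
Qed.

End D0Bounds.

(** * Estimates for independent sampling *)

Lemma one_sub_expr_le (R : realFieldType) (N : nat) (u : R) :
  0 <= u <= 1 -> 1 <= 4 * N%:R * u -> (1 - u) ^+ N <= 4 / 5.
Proof.
move=> /andP[u0 u1] Nu.
have bernoulli : 1 + N%:R * u <= (1 + u) ^+ N.
  elim: N {Nu} => [|N IH]; first by rewrite mul0r addr0 expr0.
  rewrite exprS -natr1; have Nu0 : 0 <= N%:R * u by rewrite mulr_ge0.
  have : (1 + u) * (1 + N%:R * u) <= (1 + u) * (1 + u) ^+ N by rewrite ler_wpM2l//; lra.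
  nra.
have v0 : 0 <= (1 - u) ^+ N by rewrite exprn_ge0// subr_ge0.
(* By Bernoulli the second factor is at least 1 + N u >= 5/4. *)
have : (1 - u) ^+ N * (1 + u) ^+ N <= 1.
  by rewrite -exprMn exprn_ile1//; nra.
nra.
Qed.

(** A draw lies in P with probability at least 1/(4N), so N independent draws all miss P with
    probability at most 4/5; otherwise the maximum is at least tau. *)
Lemma sum_max_ge (R : realFieldType) (T : finType) (E : T -> R) (P : pred T)
    (N : nat) (tau : R) :
  (forall x, 0 <= E x) -> (forall x, P x -> tau <= E x) -> 0 <= tau ->
  (0 < #|T|)%N -> (#|T|%:R : R) <= 4 * N%:R * #|P|%:R ->
  tau / 5 * #|T|%:R ^+ N <=
  \sum_(x : {ffun 'I_N -> T}) \big[Num.max/0]_(i < N) E (x i).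
Proof.
move=> E0 PE tau0 T0 TP.
have Tgt0 : 0 < #|T|%:R :> R by rewrite ltr0n.
pose u : R := #|P|%:R / #|T|%:R.
have uT : u * #|T|%:R = #|P|%:R by rewrite mulfVK ?gt_eqF.
have u01 : 0 <= u <= 1.
  by rewrite divr_ge0// ler_pdivrMr// mul1r ler_nat max_card.
have Nu : 1 <= 4 * N%:R * u by rewrite mulrA ler_pdivlMr ?mul1r.
have := one_sub_expr_le u01 Nu.
set v := (1 - u) ^+ N => v45.
pose miss (x : T) : R := (~~ P x)%:R.
have missE : \sum_x miss x = (1 - u) * #|T|%:R.
  rewrite mulrBl mul1r uT -(cardC P) natrD addrAC subrr add0r.
  rewrite -sum1_card natr_sum [RHS]big_mkcond /=; apply: eq_bigr => x _.
  by have -> : (x \in [predC P]) = ~~ P x by []; rewrite /miss; case: (P x).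
(* Independence: the sum over N-tuples of a product factorizes. *)
have prodE : \sum_(x : {ffun 'I_N -> T}) \prod_(i < N) miss (x i) = v * #|T|%:R ^+ N.
  rewrite -(bigA_distr_bigA (fun _ : 'I_N => miss)) prodr_const card_ord missE.
  by rewrite exprMn.
have maxE (x : {ffun 'I_N -> T}) :
    tau * (1 - \prod_(i < N) miss (x i)) <= \big[Num.max/0]_(i < N) E (x i).
  case: (boolP [exists i, P (x i)]) => [/existsP[i Pi]|].
    rewrite (bigD1 i) //= /miss Pi mul0r subr0 mulr1.
    by apply: le_trans (PE _ Pi) _; apply: (le_bigmax _ (fun i => E (x i))).
  rewrite negb_exists => /forallP nP; rewrite big1 => [|i _].
    by rewrite subrr mulr0; apply: bigmax_ge_id.
  by rewrite /miss nP.
apply: (@le_trans _ _ (\sum_(x : {ffun 'I_N -> T})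
  tau * (1 - \prod_(i < N) miss (x i)))); last first.
  by apply: ler_sum => x _; exact: maxE.
rewrite -mulr_sumr sumrB prodE sumr_const card_ffun card_ord -mulrA ler_wpM2l//.
rewrite natrX -[X in X - _]mul1r -mulrBl ler_wpM2r ?exprn_ge0//; lra.
Qed.

(* Paley-Zygmund, summing the pointwise bound
   w <= a/2 + w^2/(4 N a) + N a 1_{w >= a/2}. *)
Lemma paley_zygmund (R : realFieldType) (T : finType) (w : T -> R) (N : nat) (a : R) :
  (0 < #|T|)%N -> 0 < a -> (0 < N)%N ->
  \sum_x w x = a * #|T|%:R -> \sum_x w x ^+ 2 <= N%:R * a ^+ 2 * #|T|%:R ->
  (#|T|%:R : R) <= 4 * N%:R * #|[pred x | a / 2 <= w x]|%:R.
Proof.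
move=> T0 a0 N0 wa w2; set P := [pred x | _].
have n0 : 0 < N%:R :> R by rewrite ltr0n.
have na : 0 < N%:R * a by rewrite mulr_gt0.
have pt x : w x <= a / 2 + w x ^+ 2 / (4 * (N%:R * a)) + N%:R * a * (P x)%:R.
  have q0 : 0 <= w x ^+ 2 / (4 * (N%:R * a)) by rewrite divr_ge0 ?sqr_ge0// mulr_ge0// ltW.
  rewrite /P /=; case: (leP (a / 2) (w x)) => wx.
    (* A rearrangement of (w - 2Na)^2 >= 0. *)
    have : w x - N%:R * a <= w x ^+ 2 / (4 * (N%:R * a)).
      by rewrite ler_pdivlMr ?mulr_gt0//; have := sqr_ge0 (w x - 2 * (N%:R * a)); lra.
    by rewrite mulr1; lra.
  rewrite mulr0; lra.
have : \sum_x w x <= \sum_x (a / 2 + w x ^+ 2 / (4 * (N%:R * a)) + N%:R * a * (P x)%:R).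
  by apply: ler_sum => x _; exact: pt.
have -> : \sum_x (a / 2 + w x ^+ 2 / (4 * (N%:R * a)) + N%:R * a * (P x)%:R) =
    a / 2 * #|T|%:R + (\sum_x w x ^+ 2) / (4 * (N%:R * a)) + N%:R * a * #|P|%:R.
  rewrite !big_split /= mulr_suml; congr (_ + _ + _).
    by rewrite sumr_const mulr_natr.
  rewrite -sum1_card natr_sum mulr_sumr [RHS]big_mkcond /=; apply: eq_bigr => x _.
  by rewrite inE; case: (_ <= _); rewrite ?mulr1 ?mulr0.
rewrite wa.
have : (\sum_x w x ^+ 2) / (4 * (N%:R * a)) <= a / 4 * #|T|%:R.
  by rewrite ler_pdivrMr ?mulr_gt0//; apply: le_trans w2 _; lra.
set q := _ / _; set t : R := #|T|%:R; set k : R := #|P|%:R => le1 le2.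
(* Since 1 - 1/2 - 1/4 = 1/4, what remains is a t / 4 <= N a k. *)
rewrite -(ler_pM2l a0); lra.
Qed.

(** * Choice of the constants and of the exponent *)

Theorem theorem1p4 (R : realType) :
  exists c C : R, [/\ 0 < c, 0 < C &
    forall (n : nat) (K : set 'rV[R]_n.+1) (q : R) (N : nat),
      convex_body K ->
      @euclidean_ball R n.+1 `<=` K ->
      1 <= q ->
      (C * Dq K q) ^+ 2 <= N%:R ->
      N%:R <= expR q ->
      (\sum_(x : {ffun 'I_N -> lattice_points K})
         \big[Num.max/0]_(i < N) `|inner (val (x i)) (last_basis R n)|)
        / (lattice_count K)%:R ^+ N
      >= c * ((\sum_(x <- lattice_points K)
                 `|inner x (last_basis R n)|
                   `^ (ln N%:R / (2 * ln (C * Dq K q))))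
                / (lattice_count K)%:R)
             `^ (2 * ln (C * Dq K q) / ln N%:R)].
Proof.
(* 32 comes from the reverse Hoelder inequality; 1/10 is 1/2, from the threshold, times 1/5, from
   [sum_max_ge]. *)
exists (10^-1), 32; split; rewrite ?invr_gt0// => n K q N cK ballK q1 NC Nq.
set D := Dq K q in NC *.
have D1 : 1 <= D by have [] := @moment_cube_le_Dq R n K 1 q cK ballK; rewrite ?lexx.
have CD : 32 <= 32 * D by lra.
have CD0 : 0 < 32 * D by lra.
have N1024 : 1024 <= N%:R :> R by apply: le_trans NC; nra.
have N0 : (0 < N)%N by rewrite -(ltr_nat R); lra.
set l := ln (32 * D).
have l1 : 1 <= 2 * l.
  have : 1 - l <= expR (- l) by have := expR_ge1Dx (- l).
  rewrite expRN lnK ?posrE; last by lra.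
  have : (32 * D)^-1 <= 32^-1 by rewrite lef_pV2// posrE; lra.
  lra.
set p := ln N%:R / (2 * l).
have -> : 2 * l / ln N%:R = p^-1 by rewrite /p invf_div.
(* The lower bound on N gives p >= 1 and the upper bound p <= q, so that p is in the range of the
   supremum D_q. *)
have lN : 2 * l <= ln N%:R.
  have -> : 2 * l = ln ((32 * D) ^+ 2) by rewrite lnXn// mulr_natl.
  by rewrite ler_ln ?posrE// ?exprn_gt0; lra.
have p1 : 1 <= p by rewrite ler_pdivlMr ?mul1r; lra.
have p0 : 0 < p by lra.
have pq : p <= q.
  have lq : ln N%:R <= q by rewrite -ler_expR lnK ?posrE; lra.
  rewrite ler_pdivrMr; nra.
have [B0 KB0] : exists B, box_bounded B K by have [/compact_box_bounded] := cK.
have Ke : K (last_basis R n) by exact/ballK/last_basis_ball.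
have cvK : convex_set K by have [] := cK.
have DB := cube_sum_bounded KB0.
have KB : box_bounded (n.+1 * B0).+1 K by move=> x /sub_cube_sum; apply: DB.
have G0 := lattice_count_gt0 KB Ke.
have S1 := height_sum_ge1 p KB Ke.
have hoelder := height_reverse_hoelder cvK ballK DB p1.
have [_ SD] : _ /\ _ := @moment_cube_le_Dq R n K p q cK ballK (introT andP (conj p1 pq)).
rewrite -/D in SD.
(* The exponent p is the one for which (32 D)^(2p) = N exactly. *)
have ND : N%:R = (32 `^ p * D `^ p) ^+ 2.
  rewrite -powRM//; last by lra.
  rewrite -powR_mulrn ?powR_ge0// -powRrM.
  rewrite /powR gt_eqF; last by lra.
  rewrite -/l /p (_ : _ * l = ln N%:R) ?lnK ?posrE//; first by lra.
  by field; rewrite gt_eqF; lra.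
have sumE (f : 'rV[R]_n.+1 -> R) :
    \sum_(x <- lattice_points K) f x = \sum_(x : lattice_points K) f (val x).
  exact: big_seq_fsetE.
set G : R := (lattice_count K)%:R in G0 hoelder *.
have GE : G = #|{: lattice_points K}|%:R by rewrite /G /lattice_count cardfE.
set s := height_sum K p in S1 SD.
have -> : \sum_(x <- lattice_points K) `|inner x (last_basis R n)| `^ p = s.
  by apply: eq_bigr => x _; rewrite inner_last_basis.
pose a := s / G.
have a0 : 0 < a by rewrite divr_gt0//; lra.
have aG : s = a * G by rewrite mulfVK ?gt_eqF.
pose w (x : lattice_points K) := height (val x) `^ p.
have T0 : (0 < #|{: lattice_points K}|)%N by rewrite -(ltr_nat R) -GE.
have PZ := @paley_zygmund R (lattice_points K) w N a T0 a0 N0.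
have {}PZ : (#|{: lattice_points K}|%:R : R) <= 4 * N%:R * #|[pred x | a / 2 <= w x]|%:R.
  apply: PZ.
    by rewrite -GE -aG /s /height_sum sumE.
  have -> : \sum_x w x ^+ 2 = \sum_(x <- lattice_points K) (height x `^ p) ^+ 2.
    by rewrite sumE.
  (* After multiplication by G, the left side is at most (32^p S)^2 with S the sum over K + C_n, and
     S <= D^p s. *)
  rewrite -GE -(ler_pM2r G0); apply: le_trans hoelder _.
  rewrite ND.
  have -> : (32 `^ p * D `^ p) ^+ 2 * a ^+ 2 * G * G = (32 `^ p * (D `^ p * s)) ^+ 2.
    by rewrite aG; ring.
  by rewrite ler_sqr ?nnegrE ?mulr_ge0 ?powR_ge0 ?height_sum_ge0// ?ler_wpM2l ?powR_ge0//; lra.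
have tau0 : 0 <= a `^ p^-1 / 2 by rewrite divr_ge0 ?powR_ge0.
have max := @sum_max_ge R (lattice_points K) (fun x => `|inner (val x) (last_basis R n)|)
  [pred x | a / 2 <= w x] N (a `^ p^-1 / 2) _ _ tau0 T0 PZ.
rewrite ler_pdivlMr ?exprn_gt0//.
have -> : 10^-1 * a `^ p^-1 = a `^ p^-1 / 2 / 5 by lra.
rewrite GE; apply: max => [x|x] //=.
rewrite inner_last_basis -/(height _) => wx.
have h0 : 0 <= height (val x) by exact: normr_ge0.
(* As 1/p <= 1, (1/2)^(1/p) >= 1/2. *)
apply: (@le_trans _ _ ((a / 2) `^ p^-1)).
  rewrite powRM ?invr_ge0 ?(ltW a0)// ler_wpM2l ?powR_ge0//.
  have h : 0 < (2^-1 : R) <= 1 by apply/andP; split; lra.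
  by apply: ger1_powR => //; rewrite invf_le1.
have : (a / 2) `^ p^-1 <= (w x) `^ p^-1.
  by apply: ge0_ler_powR; rewrite ?nnegrE ?invr_ge0 ?powR_ge0 ?(ltW p0)//; lra.
by rewrite /w -powRrM divff ?gt_eqF// powRr1.
Qed.
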